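(* Let $n$ be an integer with $n\geq 2$, and let $\mathsf{K}$ be a variety of Heyting algebras all of whose members have width at most $n$. If $\boldsymbol{X}_{n}^{\infty}\in\mathsf{K}_\ast$, then $\mathsf{K}$ lacks the ES property.
   Context: Heyting algebras are algebras $\langle A;\wedge,\vee,\to,0,1\rangle$; varieties are regarded as categories with homomorphisms as morphisms. A homomorphism $f\colon \mathbf{A}\to\mathbf{B}$ in a variety $\mathsf{K}$ is an epimorphism if for all $\mathbf{C}\in\mathsf{K}$ and homomorphisms $g,h\colon\mathbf{B}\to\mathbf{C}$, $g\circ f=h\circ f$ implies $g=h$; $\mathsf{K}$ has the ES property if every epimorphism in $\mathsf{K}$ is surjective. An Esakia space is a Stone space with a partial order such that ${\uparrow}x$ is closed for every $x$ and ${\downarrow}U$ is clopen for every clopen $U$. For a Heyting algebra $\mathbf{A}$, $\mathbf{A}_\ast$ is its dual Esakia space: prime filters ordered by inclusion, with topology generated by the sets $\{F: a\in F\}$ and $\{F: a\notin F\}$, $a\in A$. For a variety $\mathsf{K}$, $\mathsf{K}_\ast$ is the class of Esakia spaces homeomorphically order-isomorphic to $\mathbf{A}_\ast$ for some $\mathbf{A}\in\mathsf{K}$ (equivalently, Esakia spaces $\boldsymbol{X}$ whose Heyting algebra $\boldsymbol{X}^\ast$ of clopen upsets belongs to $\mathsf{K}$). A poset has width at most $n$ if for every element $x$, ${\uparrow}x$ contains no antichain of $n+1$ elements; a Heyting algebra has width at most $n$ if the poset underlying $\mathbf{A}_\ast$ does. For $n\geq 2$, $\mathbb{X}_n$ is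 the poset with universe $\{a_1,\dots,a_n,b_1,\dots,b_n\}$ where $x\leq y$ iff $x=y$, or $x=a_1$ and $y\in\{b_2,\dots,b_n\}$, or $x=a_m$ for some $m>1$ and $y\in\{b_1,b_m\}$; $\boldsymbol{X}_n$ is $\mathbb{X}_n$ with the discrete topology. For Esakia spaces $\boldsymbol{X}_k$ ($k\in\omega$) with disjoint universes, $\sum\boldsymbol{X}_k$ has universe $\{\top\}\cup\bigcup_k X_k$ ($\top$ fresh), order $x\leq y$ iff $y=\top$, or $x,y\in X_k$ with $x\leq y$ in $\boldsymbol{X}_k$, or $x\in X_k$, $y\in X_m$ with $k<m$; and topology consisting of the sets $U$ such that every $U\cap X_k$ is open in $\boldsymbol{X}_k$ and, if $\top\in U$, then $\bigcup_{m\geq k}X_m\subseteq U$ for some $k$. $\boldsymbol{X}^\infty$ is the sum of $\omega$ copies of $\boldsymbol{X}$. *)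

(* Defs.v *)
From HB Require Import structures.
From mathcomp Require Import all_boot all_order.
From mathcomp Require Import all_classical topology.

Set Implicit Arguments.
Unset Strict Implicit.
Unset Printing Implicit Defensive.

Import Order.TTheory.

Local Open Scope classical_set_scope.
Local Open Scope order_scope.

HB.mixin Record hasHeytingImp d (T : Type) of Order.TBLattice d T := {
  himp : T -> T -> T;
  himpP : forall a b c : T, (a `&` b <= c) = (a <= himp b c)
}.

#[short(type="heytingType")]
HB.structure Definition Heyting d :=
  { T of Order.TBLattice d T & hasHeytingImp d T }.

Record heyting_hom {d d'} {A : heytingType d} {B : heytingType d'}
    (f : A -> B) : Prop := HeytingHom {
  hom_meet : forall a b, f (a `&` b) = f a `&` f b;
  hom_join : forall a b, f (a `|` b) = f a `|` f b;
  hom_imp : forall a b, f (himp a b) = himp (f a) (f b);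
  hom_bot : f \bot = \bot;
  hom_top : f \top = \top
}.

Inductive hterm :=
  | Var of nat
  | Meet of hterm & hterm
  | Join of hterm & hterm
  | Imp of hterm & hterm
  | Bot
  | Top.

Fixpoint heval {d} {A : heytingType d} (v : nat -> A) (t : hterm) : A :=
  match t with
  | Var i => v i
  | Meet s u => heval v s `&` heval v u
  | Join s u => heval v s `|` heval v u
  | Imp s u => himp (heval v s) (heval v u)
  | Bot => \bot
  | Top => \top
  end.

(* The order display d is a notational tag without mathematical content; a
   class of Heyting algebras ranges over all of them. *)
Definition heytingClass := forall d : Order.disp_t, heytingType d -> Prop.

Definition variety (K : heytingClass) :=
  exists E : set (hterm * hterm), forall d (A : heytingType d),
    K d A <-> forall e, E e -> forall v : nat -> A, heval v e.1 = heval v e.2.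

Definition epimorphism (K : heytingClass) {d d'}
    {A : heytingType d} {B : heytingType d'} (f : A -> B) :=
  forall d'' (C : heytingType d'') (g h : B -> C),
    K d'' C -> heyting_hom g -> heyting_hom h -> g \o f = h \o f -> g = h.

Definition ES_property (K : heytingClass) :=
  forall d d' (A : heytingType d) (B : heytingType d') (f : A -> B),
    K d A -> K d' B -> heyting_hom f -> epimorphism K f ->
    forall b : B, exists a : A, f a = b.

Definition poset_width_le {d} (n : nat) (X : porderType d) :=
  forall x : X, ~ exists s : 'I_n.+1 -> X,
    (forall i, x <= s i) /\ (forall i j, i != j -> s i >< s j).

Notation ordSpaceType := POrderedTopological.type.

Record esakia {d} (X : ordSpaceType d) : Prop := Esakia {
  esakia_compact : compact [set: X];
  esakia_hausdorff : hausdorff_space X;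
  esakia_disconnected : totally_disconnected [set: X];
  esakia_up : forall x : X, closed [set y : X | x <= y];
  esakia_down : forall U : set X, clopen U ->
    clopen [set x : X | exists2 y, U y & x <= y]
}.

Definition esakia_iso {d d'} (X : ordSpaceType d) (Y : ordSpaceType d') :=
  exists f : X -> Y, exists g : Y -> X,
    [/\ cancel f g, cancel g f, continuous f, continuous g
      & {mono f : x y / x <= y}].

Record prime_filter {d} {A : heytingType d} (F : set A) : Prop := PrimeFilter {
  pf_top : F \top;
  pf_bot : ~ F \bot;
  pf_up : forall a b, F a -> a <= b -> F b;
  pf_meet : forall a b, F a -> F b -> F (a `&` b);
  pf_prime : forall a b, F (a `|` b) -> F a \/ F b
}.

Definition dual {d} (A : heytingType d) := {F : set A | `[< prime_filter F >]}.

Section DualSpace.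
Context {d : Order.disp_t} {A : heytingType d}.

HB.instance Definition _ := Choice.on (dual A).

Definition dual_le (F G : dual A) : bool := `[< val F `<=` val G >].

Fact dual_le_refl : reflexive dual_le.
Proof. by move=> F; apply/asboolP. Qed.

Fact dual_le_anti : antisymmetric dual_le.
Proof.
move=> F G /andP[/asboolP FG /asboolP GF].
by apply: val_inj; apply/seteqP; split.
Qed.

Fact dual_le_trans : transitive dual_le.
Proof.
move=> G F H /asboolP FG /asboolP GH; apply/asboolP.
exact: subset_trans FG GH.
Qed.

HB.instance Definition _ :=
  Order.Le_isPOrder.Build d (dual A) dual_le_refl dual_le_anti dual_le_trans.

Definition dual_subbase : set_system (dual A) :=
  [set U | exists a : A, U = [set F : dual A | val F a] \/
                         U = [set F : dual A | ~ val F a]].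

HB.instance Definition _ :=
  isSubBaseTopological.Build (dual A) dual_subbase id.

End DualSpace.

Definition heyting_width_le {d} (n : nat) (A : heytingType d) :=
  poset_width_le n (dual A).

Definition dual_class (K : heytingClass) {d} (X : ordSpaceType d) :=
  esakia X /\
  exists (d' : Order.disp_t) (A : heytingType d'), K d' A /\ esakia_iso (dual A) X.

(* None is the added top element; Some (Tagged X x) with x : X k is the element
   x of the k-th summand. *)
Definition sumspace {d} (X : nat -> ordSpaceType d) := option {k : nat & X k}.

Section SumSpace.
Context {d : Order.disp_t} {X : nat -> ordSpaceType d}.

HB.instance Definition _ := Choice.on (sumspace X).

Definition sum_le (x y : sumspace X) : bool :=
  match x, y with
  | _, None => true
  | None, Some _ => false
  | Some u, Some v =>
      (tag u < tag v)%N ||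
      ((tag u == tag v) && (tagged u <= tagged_as u v))
  end.

Fact sum_le_refl : reflexive sum_le.
Proof. by case=> [[k x]|] //=; rewrite tagged_asE eqxx lexx orbT. Qed.

Fact sum_le_anti : antisymmetric sum_le.
Proof.
case=> [[k x]|] [[m y]|] //= /andP[/orP[km|/andP[/eqP/= km xy]]].
  by case/orP => [mk|/andP[/eqP/= mk]];
    [have := ltn_trans km mk; rewrite ltnn | rewrite mk ltnn in km].
case: m / km y xy => y; rewrite ltnn !tagged_asE eqxx /= => xy yx.
by congr (Some (Tagged _ _)); apply/le_anti; rewrite xy yx.
Qed.

Fact sum_le_trans : transitive sum_le.
Proof.
case=> [[m y]|] [[k x]|] [[l z]|] //=.
case/orP => [km|/andP[/eqP/= km xy]].
  have [ml _|_ /=] := ltnP m l; first by rewrite (ltn_trans km ml).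
  by case/andP=> /eqP ml _; have -> : (k < l)%N by rewrite -ml.
case: m / km y xy => y; rewrite !tagged_asE => xy.
case/orP => [-> //|/andP[/eqP/= kl]].
case: l / kl z => z; rewrite !tagged_asE eqxx => yz.
by rewrite (le_trans xy yz) orbT.
Qed.

HB.instance Definition _ :=
  Order.Le_isPOrder.Build d (sumspace X) sum_le_refl sum_le_anti sum_le_trans.

Definition sum_open : set_system (sumspace X) := [set U |
  (forall k, open [set x : X k | U (Some (Tagged X x))]) /\
  (U None -> exists k, forall m (x : X m), (k <= m)%N -> U (Some (Tagged X x)))].

Fact sum_openT : sum_open setT.
Proof. by split=> [k|_]; [exact: openT | exists 0]. Qed.

Fact sum_openI : setI_closed sum_open.
Proof.
move=> U V [oU tU] [oV tV]; split=> [k|[/tU[k Uk] /tV[l Vl]]].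
  exact: openI.
exists (maxn k l) => m x; rewrite geq_max => /andP[km lm].
by split; [exact: Uk | exact: Vl].
Qed.

Fact sum_open_bigU (I : Type) (f : I -> set (sumspace X)) :
  (forall i, sum_open (f i)) -> sum_open (\bigcup_i f i).
Proof.
move=> of_; split=> [k|[i _ fi]].
  rewrite (_ : [set _ | _] =
    \bigcup_i [set x : X k | f i (Some (Tagged X x))]) //.
  by apply: bigcup_open => i _; exact: (of_ i).1.
by have [k fk] := (of_ i).2 fi; exists k => m x km; exists i => //; exact: fk.
Qed.

HB.instance Definition _ :=
  isOpenTopological.Build (sumspace X) sum_openT sum_openI sum_open_bigU.

End SumSpace.

Definition omega_sum {d} (X : ordSpaceType d) := sumspace (fun=> X).

(* a_(i+1) is inl i and b_(i+1) is inr i. *)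
Definition XX (n : nat) := ('I_n + 'I_n)%type.

Section XX.
Context {n : nat}.

HB.instance Definition _ := Choice.on (XX n).

Definition XX_le (x y : XX n) : bool :=
  (x == y) ||
  match x, y with
  | inl i, inr j =>
      if i == 0 :> nat then j != 0 :> nat
      else (j == 0 :> nat) || (j == i)
  | _, _ => false
  end.

Fact XX_le_refl : reflexive XX_le.
Proof. by move=> x; rewrite /XX_le eqxx. Qed.

Fact XX_le_anti : antisymmetric XX_le.
Proof. by case=> i [] j /andP[/orP[/eqP//|] //= _ /orP[/eqP//|]]. Qed.

Fact XX_le_trans : transitive XX_le.
Proof.
move=> y x z /orP[/eqP-> //|xy] /orP[/eqP<-|yz].
  by rewrite /XX_le xy orbT.
by case: x y z xy yz => i [] j [] k.
Qed.

HB.instance Definition _ := Order.Le_isPOrder.Build (Order.Disp tt tt) (XX n)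
  XX_le_refl XX_le_anti XX_le_trans.

HB.instance Definition _ := hasNbhs.Build (XX n) principal_filter.
HB.instance Definition _ := Discrete_ofNbhs.Build (XX n) erefl.

End XX.

(* Main.v *)
Require Import Defs.
From HB Require Import structures.
From mathcomp Require Import all_boot all_order all_classical topology.

(** Write a_m^k, b_m^k for the points of the k-th copy of X_n in X := X_n^oo,
    and let A be an algebra in K with dual space X. The map sending b_1^k to
    a_1^(k+1), a_m^k to b_m^k for m > 1, and fixing all other points is a
    closure operator on X; the elements of A whose clopen upsets are unions of
    its fibres therefore form a subalgebra, which is proper since a_m^0 and
    b_m^0 lie in one fibre for m > 1. Its inclusion into A is an epimorphism:
    if two homomorphisms from A to C agree on it, their dual maps
    G, H : C_* -> X are p-morphisms that agree up to fibres. Were they to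
    differ, some point v would satisfy, up to symmetry, G v = a_m^k and
    H v = b_m^k with m > 1; lifting points of X along G and H then yields an
    antichain of n + 1 elements above v, contradicting the width bound on C. *)

Set Implicit Arguments.
Unset Strict Implicit.
Unset Printing Implicit Defensive.

Import Order.TTheory.

Local Open Scope classical_set_scope.
Local Open Scope order_scope.

Lemma compact_directed_cover (T : topologicalType) (I : Type) (D : set I)
    (f : I -> set T) (K : set T) :
  compact K -> D !=set0 -> (forall i, D i -> open (f i)) ->
  (forall i j, D i -> D j -> exists2 k, D k & f i `|` f j `<=` f k) ->
  K `<=` \bigcup_(i in D) f i -> exists2 i, D i & K `<=` f i.
Proof.
move=> /compact_near_coveringP cptK D0 f_open f_dir Kf.
pose tail i := [set j | D j /\ f i `<=` f j].
have tail_filter : Filter (filter_from D tail).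
  apply: filter_from_filter => // i j Di Dj.
  have [k Dk] := f_dir i j Di Dj; rewrite subUset => -[fik fjk].
  by exists k => // l [Dl fkl]; split; split=> //; exact: subset_trans fkl.
have [x /Kf[i Di fx]|i Di Kfi] := cptK _ (filter_from D tail) f _.
  exists (f i, tail i).
    by split; [apply: open_nbhs_nbhs; split=> //; exact: f_open|exists i].
  by move=> [y j] [/= fiy [_ fij]]; exact: fij.
by exists i => //; apply: Kfi; split.
Qed.

Section LatticeFilters.
Context {d : Order.disp_t} {L : tbLatticeType d}.
Implicit Types (F I N : set L) (C : set (set L)) (a b : L).

Record lattice_filter F : Prop := LatticeFilter {
  filter_top : F \top;
  filter_up : forall a b, F a -> a <= b -> F b;
  filter_meet : forall a b, F a -> F b -> F (a `&` b)
}.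

Record lattice_ideal I : Prop := LatticeIdeal {
  ideal_bot : I \bot;
  ideal_down : forall a b, I b -> a <= b -> I a;
  ideal_join : forall a b, I a -> I b -> I (a `|` b)
}.

Lemma filter_principal a : lattice_filter [set b | a <= b].
Proof.
split=> [|b c|b c /= ab ac]; [exact: lex1|exact: le_trans|].
by rewrite lexI ab.
Qed.

Lemma ideal_principal a : lattice_ideal [set b | b <= a].
Proof.
split=> [|b c /[swap]|b c /= ba ca]; [exact: le0x|exact: le_trans|].
by rewrite leUx ba.
Qed.

Lemma filter_bigcup C : C !=set0 -> total_on C subset ->
  C `<=` lattice_filter -> lattice_filter (\bigcup_(F in C) F).
Proof.
move=> [F0 CF0] Ctot Cfilter; split.
- by exists F0 => //; exact: filter_top (Cfilter _ CF0).
- move=> a b [F CF Fa] ab; exists F => //.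
  exact: (filter_up (Cfilter _ CF) Fa).
- move=> a b [F CF Fa] [G CG Gb].
  have [FG|GF] := Ctot _ _ CF CG.
    by exists G => //; apply: (filter_meet (Cfilter _ CG)) Gb; exact: FG.
  by exists F => //; apply: (filter_meet (Cfilter _ CF)) Fa _; exact: GF.
Qed.

Lemma filter_maximal_sub F N : lattice_filter F -> F `<=` N ->
  exists M, [/\ lattice_filter M, F `<=` M, M `<=` N &
    forall G, lattice_filter G -> M `<=` G -> G `<=` N -> G `<=` M].
Proof.
move=> fF FN.
pose admissible G := [/\ lattice_filter G, F `<=` G & G `<=` N].
pose F0 : {G | admissible G} := exist _ F (And3 fF (@subset_refl _ F) FN).
pose R (G H : {G | admissible G}) := `[< sval G `<=` sval H >].
have [|||[M [fM FM MN]] Mmax] := @ZL_preorder _ F0 R.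
- by move=> G; apply/asboolP.
- by move=> G H J /asboolP HG /asboolP GJ; apply/asboolP/(subset_trans HG).
- move=> C Ctot; have [->|/set0P[G CG]] := eqVneq C set0; first by exists F0.
  have good : admissible (\bigcup_(H in [set sval H | H in C]) H).
    split.
    + apply: filter_bigcup; first by exists (sval G), G.
        move=> _ _ [H CH <-] [J CJ <-].
        by have [/asboolP|/asboolP] := Ctot _ _ CH CJ; [left|right].
      by move=> _ [H _ <-]; have [] := svalP H.
    + move=> a Fa; exists (sval G); first by exists G.
      by have [_ FG _] := svalP G; exact: FG.
    + by move=> a [_ [H _ <-]]; have [_ _ HN] := svalP H; exact: HN.
  exists (exist _ _ good) => H CH; apply/asboolP => a Ha.
  by exists (sval H) => //; exists H.
exists M; split=> // G fG MG GN.
have aG : admissible G by split=> //; exact: subset_trans MG.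
by apply/asboolP/(Mmax (exist _ G aG)); apply/asboolP.
Qed.

End LatticeFilters.

Section HeytingFilters.
Context {d : Order.disp_t} {A : heytingType d}.
Implicit Types (F I M : set A) (a b c : A).

Lemma himp_mp a b : himp a b `&` a <= b.
Proof. by rewrite himpP. Qed.

Lemma le_himpr a b c : b <= c -> himp a b <= himp a c.
Proof. by move=> bc; rewrite -himpP (le_trans (himp_mp a b)). Qed.

Lemma himpI_le_himpU a b c : himp a c `&` himp b c <= himp (a `|` b) c.
Proof.
rewrite -himpP meetC himpP leUx -!himpP ![_ `&` (_ `&` _)]meetC.
by rewrite (himpP _ a) (himpP _ b) leIl leIr.
Qed.

(* [set b | F (himp a b)] is the filter generated by F and a. *)
Lemma filter_himp F a :
  lattice_filter F -> lattice_filter [set b | F (himp a b)].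
Proof.
move=> fF; split=> [|b c /= Fb bc|b c /= Fb Fc] /=.
- by apply: (filter_up fF) (filter_top fF) _; rewrite -himpP lex1.
- exact: (filter_up fF Fb (le_himpr a bc)).
- apply: (filter_up fF) (filter_meet fF Fb Fc) _.
  by rewrite -himpP lexI (himpP _ a b) (himpP _ a c) leIl leIr.
Qed.

Lemma sub_filter_himp F a : lattice_filter F -> F `<=` [set b | F (himp a b)].
Proof. by move=> fF b Fb; apply: (filter_up fF) Fb _; rewrite -himpP leIl. Qed.

Lemma filter_himp_self F a : lattice_filter F -> F (himp a a).
Proof.
by move=> fF; apply: (filter_up fF) (filter_top fF) _; rewrite -himpP leIr.
Qed.

Lemma filter_mp F a b : lattice_filter F -> F (himp a b) -> F a -> F b.
Proof.
by move=> fF Fab Fa; apply: (filter_up fF) (himp_mp a b); exact: filter_meet.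
Qed.

Lemma prime_lattice_filter F : prime_filter F -> lattice_filter F.
Proof. by case. Qed.

Lemma prime_filterC_ideal F : prime_filter F -> lattice_ideal (~` F).
Proof.
move=> pF; split=> [|a b nFb ab Fa|a b nFa nFb /(pf_prime pF)[]//].
  exact: pf_bot.
by apply: nFb; exact: pf_up ab.
Qed.

Lemma maximal_filter_prime M I : lattice_filter M -> lattice_ideal I ->
    M `<=` ~` I ->
    (forall G, lattice_filter G -> M `<=` G -> G `<=` ~` I -> G `<=` M) ->
  prime_filter M.
Proof.
move=> fM iI MI Mmax.
have himp_into_ideal a : ~ M a -> exists2 i, I i & M (himp a i).
  move=> nMa; apply: contrapT => noi; apply: nMa.
  apply: (Mmax [set b | M (himp a b)]).
  - exact: filter_himp.
  - exact: sub_filter_himp.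
  - by move=> b Mab Ib; apply: noi; exists b.
  - exact: filter_himp_self.
split; [exact: filter_top|by move=> /MI; apply; exact: ideal_bot
       |exact: filter_up|exact: filter_meet|].
move=> a b Mab; apply: contrapT.
move=> /not_orP[/himp_into_ideal[i Ii Mai] /himp_into_ideal[j Ij Mbj]].
apply: (MI (i `|` j)); last exact: ideal_join.
apply: (filter_mp fM) Mab.
apply: (filter_up fM) (filter_meet fM Mai Mbj) _.
by apply: le_trans (himpI_le_himpU _ _ _); rewrite leI2 ?le_himpr ?leUl ?leUr.
Qed.

Definition to_dual F (pF : prime_filter F) : dual A := exist _ F (asboolT pF).

Lemma prime_filter_theorem F I : lattice_filter F -> lattice_ideal I ->
  F `<=` ~` I -> exists P : dual A, F `<=` val P /\ val P `<=` ~` I.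
Proof.
move=> fF iI /(filter_maximal_sub fF)[M [fM FM MI Mmax]].
by exists (to_dual (maximal_filter_prime fM iI MI Mmax)).
Qed.

End HeytingFilters.

Section Stone.
Context {d : Order.disp_t} {A : heytingType d}.
Implicit Types (F G : dual A) (a b : A) (U K : set (dual A)).

Lemma dual_prime F : prime_filter (val F).
Proof. exact/asboolP/(valP F). Qed.

Definition stone a : set (dual A) := [set F | val F a].

Lemma stone_up a F G : stone a F -> F <= G -> stone a G.
Proof. by move=> Fa /asboolP; apply. Qed.

Lemma not_dual_le F G : ~~ (F <= G) -> exists2 a, stone a F & ~ stone a G.
Proof.
move=> /asboolPn FG; apply: contrapT => noa; apply: FG => a Fa.
by apply: contrapT => nGa; apply: noa; exists a.
Qed.

Lemma stone1 : stone \top = setT.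
Proof. by apply/seteqP; split=> // F _; exact: pf_top (dual_prime F). Qed.

Lemma stone0 : stone \bot = set0.
Proof. by apply/seteqP; split=> // F; exact: pf_bot (dual_prime F). Qed.

Lemma le_stone_sub a b : a <= b -> stone a `<=` stone b.
Proof. by move=> ab F Fa; exact: (pf_up (dual_prime F) Fa). Qed.

Lemma stoneI a b : stone (a `&` b) = stone a `&` stone b.
Proof.
apply/seteqP; split=> F; last by case=> Fa Fb; exact: (pf_meet (dual_prime F)).
by move=> Fab; split; apply: (le_stone_sub _ Fab); [exact: leIl|exact: leIr].
Qed.

Lemma stoneU a b : stone (a `|` b) = stone a `|` stone b.
Proof.
apply/seteqP; split=> F; first exact: (pf_prime (dual_prime F)).
by case=> Fx; apply: (le_stone_sub _ Fx); [exact: leUl|exact: leUr].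
Qed.

Lemma stone_himp a b :
  stone (himp a b) = [set F | forall G, F <= G -> stone a G -> stone b G].
Proof.
apply/seteqP; split=> F Fab.
  move=> G /(stone_up Fab) Gab Ga.
  exact: (filter_mp (prime_lattice_filter (dual_prime G)) Gab Ga).
have fF := prime_lattice_filter (dual_prime F).
apply: contrapT => nFab.
have [c /= Fac cb|P [FP Pb]] :=
    prime_filter_theorem (filter_himp a fF) (ideal_principal b).
  by apply: nFab; exact: (filter_up fF Fac (le_himpr a cb)).
apply: (Pb b); last exact: lexx.
apply: Fab; first by apply/asboolP => c Fc; apply: FP; exact: sub_filter_himp.
by apply: FP; exact: filter_himp_self.
Qed.

Lemma stone_sub_le a b : stone a `<=` stone b -> a <= b.
Proof.
move=> ab; apply: contrapT => nab.
have [c /= ac cb|P [aP Pb]] :=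
    prime_filter_theorem (filter_principal a) (ideal_principal b).
  exact/nab/(le_trans ac).
by apply: (Pb b); [apply/ab/aP => /=|exact: lexx].
Qed.

Lemma open_stone a : open (stone a).
Proof.
exists [set stone a]; last by rewrite bigcup_set1.
by move=> _ ->; apply: (finI_from1 id); exists a; left.
Qed.

Lemma open_stoneC a : open (~` stone a).
Proof.
exists [set ~` stone a]; last by rewrite bigcup_set1.
by move=> _ ->; apply: (finI_from1 id); exists a; right.
Qed.

Lemma ultrafilter_prime (UF : set_system (dual A)) : UltraFilter UF ->
  prime_filter [set a | UF (stone a)].
Proof.
move=> uUF; split=> /= [||a b Fa ab|a b Fa Fb|a b].
- by rewrite stone1; exact: filterT.
- by rewrite stone0; exact: filter_not_empty.
- by apply: filterS Fa; exact: le_stone_sub.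
- by rewrite stoneI; exact: filterI.
- rewrite stoneU => Fab.
  have [Fa|nFa] := in_ultra_setVsetC (stone a) uUF; first by left.
  by right; apply: filterS2 nFa Fab => F nFa [].
Qed.

Lemma dual_compact : compact [set: dual A].
Proof.
rewrite compact_ultra => UF uUF _.
pose L := to_dual (ultrafilter_prime uUF); exists L; split=> // U.
rewrite nbhsE => -[V [[D Dfin <-] [W DW LW]] VU].
apply: filterS VU _; apply: filterS (bigcup_sup DW) _.
have [S Ssub WE] := Dfin _ DW; rewrite -WE in LW *.
apply: filter_bigI => V0 SV0; have /set_mem[a [VE|VE]] := Ssub _ SV0.
  by have := LW _ SV0; rewrite /= VE.
have := LW _ SV0; rewrite /= VE /= => nLa.
by have [/nLa|] := in_ultra_setVsetC (stone a) uUF.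
Qed.

Lemma ideal_stone_cover (I : set A) K : lattice_ideal I -> compact K ->
  K `<=` \bigcup_(a in I) stone a -> exists2 a, I a & K `<=` stone a.
Proof.
move=> iI cptK; apply: compact_directed_cover => //.
- by exists \bot; exact: ideal_bot.
- by move=> a _; exact: open_stone.
- move=> a b Ia Ib; exists (a `|` b); first exact: ideal_join.
  by rewrite stoneU.
Qed.

Lemma filter_stoneC_cover (F : set A) K : lattice_filter F -> compact K ->
  K `<=` \bigcup_(a in F) ~` stone a -> exists2 a, F a & K `<=` ~` stone a.
Proof.
move=> fF cptK; apply: compact_directed_cover => //.
- by exists \top; exact: filter_top.
- by move=> a _; exact: open_stoneC.
- move=> a b Fa Fb; exists (a `&` b); first exact: filter_meet.
  by rewrite stoneI -setCI.
Qed.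

Lemma clopen_upset_stone U : clopen U -> (forall F G, U F -> F <= G -> U G) ->
  exists a, U = stone a.
Proof.
move=> [oU cU] upU.
have cptU : compact U by apply: (subclosed_compact cU dual_compact).
have cptCU : compact (~` U).
  by apply: (subclosed_compact _ dual_compact) => //; exact: open_closedC.
have fU : lattice_filter [set a | U `<=` stone a].
  split=> [|a b Ua /le_stone_sub|a b Ua Ub] /=.
  - by rewrite stone1.
  - exact: subset_trans.
  - by rewrite stoneI subsetI.
have [G nUG|a Ua UCa] := filter_stoneC_cover fU cptCU.
  have iG := prime_filterC_ideal (dual_prime G).
  have [F UF|a nGa Ua] := ideal_stone_cover iG cptU.
    have [|a Fa nGa] := @not_dual_le F G; last by exists a.
    by apply/negP => /(upU _ _ UF).
  by exists a.
by exists a; apply/seteqP; split=> //; exact: subsetC2.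
Qed.

End Stone.

Record p_morphism {d d'} {X : porderType d} {Y : porderType d'} (f : X -> Y) :
    Prop := PMorphism {
  p_morphism_homo : {homo f : x y / x <= y};
  p_morphism_lift : forall x y, f x <= y -> exists2 z, x <= z & f z = y
}.

Lemma p_morphism_iso_comp {d d' d''} {X : porderType d} {Y : porderType d'}
    {Z : porderType d''} (f : X -> Y) (g : Y -> Z) (h : Z -> Y) :
  cancel h g -> {mono g : x y / x <= y} -> p_morphism f -> p_morphism (g \o f).
Proof.
move=> hK g_mono [f_homo f_lift]; split=> [x y xy|x y] /=.
  by rewrite g_mono f_homo.
rewrite -{1}[y]hK g_mono => /f_lift[z xz fz].
by exists z; rewrite //= fz hK.
Qed.

Definition p_monic {d d'} (Z : porderType d) {X : porderType d'} (c : X -> X) :=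
  forall g h : Z -> X, p_morphism g -> p_morphism h ->
  c \o g =1 c \o h -> g =1 h.

Lemma p_monic_conj {d d' d''} (Z : porderType d) {X : porderType d'}
    {Y : porderType d''} (c : X -> X) (f : Y -> X) (g : X -> Y) :
  cancel f g -> cancel g f -> {mono f : x y / x <= y} ->
  p_monic Z c -> p_monic Z (g \o c \o f).
Proof.
move=> fK gK f_mono c_monic h k ph pk chk v; apply: (can_inj fK).
apply: (c_monic (f \o h) (f \o k)); [exact: p_morphism_iso_comp gK _ _..|].
by move=> w; exact: (can_inj gK (chk w)).
Qed.

Lemma poset_width_comparable {d} {X : porderType d} n (v t : X)
    (w : 'I_n -> X) :
    poset_width_le n X -> v <= t -> (forall j, v <= w j) ->
    (forall i j, i != j -> w i >< w j) ->
  exists j, t >=< w j.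
Proof.
move=> width vt vw ww; apply: contrapT => tw; apply: (width v).
have ntw j : t >< w j by apply/negP => tj; apply: tw; exists j.
exists (fun r : 'I_n.+1 => if unlift ord0 r is Some j then w j else t).
split=> [r|r s]; first by case: unliftP.
case: (unliftP ord0 r) => [i ->|->]; case: (unliftP ord0 s) => [j ->|->] //.
- by rewrite (inj_eq lift_inj) => /ww.
- by rewrite comparable_sym.
Qed.

Section DualMap.
Context {d d' : Order.disp_t} {A : heytingType d} {B : heytingType d'}.
Variables (f : A -> B) (hf : heyting_hom f).

Lemma hom_le a b : a <= b -> f a <= f b.
Proof. by rewrite !leEmeet -(hom_meet hf) => /eqP->. Qed.

Lemma preimage_prime_filter (P : set B) :
  prime_filter P -> prime_filter (f @^-1` P).
Proof.
move=> pP; split=> [||a b Pa ab|a b Pa Pb|a b] /=.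
- by rewrite (hom_top hf); apply: pf_top.
- by rewrite (hom_bot hf); apply: pf_bot.
- exact: (pf_up pP) (hom_le ab).
- by rewrite (hom_meet hf); apply: pf_meet.
- by rewrite (hom_join hf); apply: pf_prime.
Qed.

Definition dual_map (P : dual B) : dual A :=
  to_dual (preimage_prime_filter (dual_prime P)).

Lemma exists_dual_map_le (F : set B) (Q : dual A) :
  lattice_filter F -> f @^-1` F `<=` val Q ->
  exists P : dual B, F `<=` val P /\ dual_map P <= Q.
Proof.
move=> fF FQ.
have iI : lattice_ideal [set b | exists2 a, ~ val Q a & b <= f a].
  have iQ := prime_filterC_ideal (dual_prime Q); split.
  - by exists \bot; [exact: ideal_bot iQ|exact: le0x].
  - by move=> b c [a Qa ca] bc; exists a => //; exact: le_trans ca.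
  - move=> b c [a Qa ba] [a' Qa' ca']; exists (a `|` a').
      exact: ideal_join iQ _ _ Qa Qa'.
    by rewrite (hom_join hf) leU2.
have [b Fb [a Qa ba]|P [FP PI]] := prime_filter_theorem fF iI.
  by apply: Qa; apply: FQ; exact: filter_up fF _ _ Fb ba.
exists P; split=> //; apply/asboolP => a Pa.
by apply: contrapT => Qa; apply: (PI _ Pa); exists a.
Qed.

Lemma dual_map_p_morphism : p_morphism dual_map.
Proof.
split=> [P P' /asboolP PP'|P Q /asboolP PQ].
  by apply/asboolP => a; exact: PP'.
pose F := [set c | exists p q, [/\ val P p, val Q q & p `&` f q <= c]].
have fP := prime_lattice_filter (dual_prime P).
have fQ := prime_lattice_filter (dual_prime Q).
have fF : lattice_filter F.
  split.
  - by exists \top, \top; split; [exact: filter_top..|exact: lex1].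
  - move=> a b [p [q [Pp Qq pa]]] ab; exists p, q.
    by split=> //; exact: le_trans ab.
  - move=> a b [p [q [Pp Qq pa]]] [p' [q' [Pp' Qq' pb]]].
    exists (p `&` p'), (q `&` q'); split; [exact: filter_meet..|].
    by rewrite (hom_meet hf) meetACA leI2.
have [a [p [q [Pp Qq pa]]]|P' [FP' P'Q]] := @exists_dual_map_le F Q fF.
  apply: (filter_mp fQ) (Qq); apply: PQ => /=.
  by rewrite (hom_imp hf); apply: (filter_up fP) Pp _; rewrite -himpP.
exists P'.
  by apply/asboolP => p Pp; apply: FP'; exists p, \top; split=> //;
    [exact: filter_top|exact: leIl].
apply/le_anti; rewrite P'Q; apply/asboolP => a Qa; apply: FP' => /=.
by exists \top, a; split=> //; [exact: filter_top|exact: leIr].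
Qed.

End DualMap.

Lemma dual_map_inj {d d'} {A : heytingType d} {B : heytingType d'}
    (f g : A -> B) (hf : heyting_hom f) (hg : heyting_hom g) :
  dual_map hf =1 dual_map hg -> f = g.
Proof.
move=> fg; have stoneE a : stone (f a) = stone (g a).
  by apply/funext => P; exact: (congr1 (fun F : dual A => val F a) (fg P)).
apply/funext => a; apply/le_anti/andP.
by split; apply: stone_sub_le; rewrite stoneE.
Qed.

Lemma heval_hom {d d'} {A : heytingType d} {B : heytingType d'} (f : A -> B)
    (v : nat -> A) t :
  heyting_hom f -> f (heval v t) = heval (f \o v) t.
Proof.
case=> fI fU fi f0 f1.
by elim: t => //= [s IHs u IHu|s IHs u IHu|s IHs u IHu];
  rewrite ?fI ?fU ?fi IHs IHu.
Qed.

Lemma variety_injective_hom (K : heytingClass) {d d'} {A : heytingType d}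
    {B : heytingType d'} (f : A -> B) :
  variety K -> heyting_hom f -> injective f -> K d' B -> K d A.
Proof.
move=> [E KE] hf f_inj /KE KB; apply/KE => e Ee v; apply: f_inj.
by rewrite !heval_hom //; exact: KB.
Qed.

Record heyting_closed {d} {A : heytingType d} (S : set A) : Prop :=
  HeytingClosed {
    closed_meet : forall a b, S a -> S b -> S (a `&` b);
    closed_join : forall a b, S a -> S b -> S (a `|` b);
    closed_imp : forall a b, S a -> S b -> S (himp a b);
    closed_bot : S \bot;
    closed_top : S \top
  }.

Definition subalgebra {d} {A : heytingType d} (S : set A)
  of heyting_closed S := {a : A | a \in S}.

Section Subalgebra.
Context {d : Order.disp_t} {A : heytingType d} {S : set A}.
Variable cS : heyting_closed S.
Notation T := (subalgebra cS).

HB.instance Definition _ := SubChoice.on T.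

Fact subalgebra_meet : {in S &, forall u v, u `&` v \in S}.
Proof.
by move=> a b /set_mem Sa /set_mem Sb; apply/mem_set/(closed_meet cS).
Qed.

Fact subalgebra_join : {in S &, forall u v, u `|` v \in S}.
Proof.
by move=> a b /set_mem Sa /set_mem Sb; apply/mem_set/(closed_join cS).
Qed.

HB.instance Definition _ := Order.SubChoice_isTBSubLattice.Build d A (mem S) d T
  subalgebra_meet subalgebra_join
  (mem_set (closed_bot cS)) (mem_set (closed_top cS)).

Fact subalgebra_imp_subproof (a b : T) : himp (val a) (val b) \in S.
Proof. by apply/mem_set/(closed_imp cS) => //; apply/set_mem/valP. Qed.

Definition subalgebra_imp (a b : T) : T :=
  exist _ (himp (val a) (val b)) (subalgebra_imp_subproof a b).

Fact subalgebra_impP (a b c : T) : (a `&` b <= c) = (a <= subalgebra_imp b c).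
Proof. exact: himpP. Qed.

HB.instance Definition _ := hasHeytingImp.Build d T subalgebra_impP.

Lemma subalgebra_hom : heyting_hom (val : T -> A).
Proof. by split. Qed.

Lemma eq_in_subalgebra {B : Type} (g h : A -> B) :
  g \o (val : T -> A) = h \o val -> {in S, g =1 h}.
Proof. by move=> gh a Sa; exact: (congr1 (@^~ (exist _ a Sa : T)) gh). Qed.

End Subalgebra.

(* The single equivalence packs extensivity, monotonicity and idempotence. *)
Definition closure_op {d} {X : porderType d} (c : X -> X) :=
  forall x y, (x <= c y) = (c x <= c y).

Definition thin_fibres {T : Type} (c : T -> T) :=
  forall x y, c x = c y -> [\/ x = y, x = c x | y = c y].

Section ClosureOp.
Context {d : Order.disp_t} {X : porderType d} {c : X -> X}.
Hypothesis closure_c : closure_op c.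

Lemma closure_op_ge x : x <= c x.
Proof. by rewrite closure_c. Qed.

Lemma closure_op_homo : {homo c : x y / x <= y}.
Proof. by move=> x y xy; rewrite -closure_c (le_trans xy) ?closure_op_ge. Qed.

Lemma closure_op_conj {d'} {Y : porderType d'} (f : Y -> X) (g : X -> Y) :
  cancel g f -> {mono f : x y / x <= y} -> closure_op (g \o c \o f).
Proof. by move=> gK f_mono x y; rewrite -!f_mono /= !gK closure_c. Qed.

Lemma p_morphism_lift_fibre {d'} {Z : porderType d'} (g h : Z -> X) v x :
    thin_fibres c -> p_morphism g -> p_morphism h -> c \o g =1 c \o h ->
    g v <= x -> (h v <= x -> h v = c x) ->
  exists w, [/\ v <= w, g w = x & h w = c x].
Proof.
move=> thin_c [_ g_lift] [h_homo _] cgh /g_lift[w vw gw] hvx.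
exists w; split=> //.
have chw : c (h w) = c x by rewrite -gw; exact/esym/cgh.
have hw_le : h w <= c x by rewrite -chw closure_op_ge.
have hvw := h_homo _ _ vw.
have [/hvx hv|/negP nhvx] := boolP (h v <= x).
  by apply/le_anti; rewrite hw_le -hv hvw.
have [hwx|->//|xc] := thin_c _ _ chw; case: nhvx; first by rewrite -hwx.
by rewrite xc (le_trans hvw).
Qed.

End ClosureOp.

Section SaturatedSubalgebra.
Context {d : Order.disp_t} {A : heytingType d}.
Implicit Types F G : dual A.
Variable c : dual A -> dual A.
Hypothesis closure_c : closure_op c.

Definition saturated : set A := [set a | c @^-1` stone a `<=` stone a].

Lemma saturated_closed : heyting_closed saturated.
Proof.
split=> [a b|a b|a b _||] /=.
- by rewrite /saturated /= !stoneI preimage_setI; exact: setISS.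
- by rewrite /saturated /= !stoneU preimage_setU; exact: setUSS.
- move=> sb F /=; rewrite stone_himp => ab G FG Ga; apply: sb.
  apply: ab; first exact: closure_op_homo.
  exact/(stone_up Ga)/closure_op_ge.
- by rewrite /saturated /= stone0 preimage_set0.
- by rewrite /saturated /= stone1.
Qed.

Hypothesis clopen_down_c :
  forall F G, ~~ (c F <= c G) -> clopen [set P | P <= c G].

Lemma saturated_separates F G : ~~ (c F <= c G) ->
  exists a, [/\ saturated a, stone a F & ~ stone a G].
Proof.
move=> FG.
have [|a aE] := clopen_upset_stone (clopenC set0 (clopen_down_c FG)).
  by move=> P Q nP PQ; apply: contra_not nP; exact: le_trans.
exists a; split; rewrite -?aE /=.
- by rewrite /saturated /= -aE => P /=; rewrite -closure_c.
- by rewrite closure_c; exact/negP.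
- by apply; exact: closure_op_ge.
Qed.

Lemma closure_op_dual_map_le {d'} {C : heytingType d'} (g h : A -> C)
    (hg : heyting_hom g) (hh : heyting_hom h) (P : dual C) :
  {in saturated, g =1 h} -> c (dual_map hg P) <= c (dual_map hh P).
Proof.
move=> gh; apply: contrapT => /negP /saturated_separates[a [/mem_set/gh sa]].
by rewrite /stone /= sa.
Qed.

Lemma saturated_epimorphism (K : heytingClass) :
    (forall d' (C : heytingType d'), K d' C -> p_monic (dual C) c) ->
  epimorphism K (val : subalgebra saturated_closed -> A).
Proof.
move=> monic_c d' C g h KC hg hh /eq_in_subalgebra gh.
apply: (@dual_map_inj _ _ _ _ _ _ hg hh).
apply: (monic_c _ _ KC); [exact: dual_map_p_morphism..|].
move=> P; apply/le_anti/andP; split; apply: closure_op_dual_map_le => // a /gh.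
exact: esym.
Qed.

Lemma not_ES_saturated (K : heytingClass) F :
    variety K -> K d A -> ~~ (c F <= F) ->
    (forall d' (C : heytingType d'), K d' C -> p_monic (dual C) c) ->
  ~ ES_property K.
Proof.
move=> varK KA /not_dual_le[a cFa nFa] monic_c ES.
have hT := subalgebra_hom saturated_closed.
have KT := variety_injective_hom varK hT val_inj KA.
have [b ba] := ES _ _ _ _ _ KT KA hT (saturated_epimorphism monic_c) a.
by apply: nFa; have /set_mem := valP b; rewrite ba; apply.
Qed.

End SaturatedSubalgebra.

Lemma not_ES_closure_op (K : heytingClass) {d} {X : ordSpaceType d} (c : X -> X)
    (x : X) :
    variety K -> dual_class K X -> closure_op c ->
    (forall y z, ~~ (c y <= c z) -> clopen [set w | w <= c z]) ->
    ~~ (c x <= x) ->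
    (forall d' (C : heytingType d'), K d' C -> p_monic (dual C) c) ->
  ~ ES_property K.
Proof.
move=> varK [_ [d' [A [KA [f [g [fK gK f_cont _ f_mono]]]]]]].
move=> closure_c clopen_down_c c_moves monic_c.
have closure_gcf := closure_op_conj closure_c gK f_mono.
apply: (not_ES_saturated closure_gcf _ (F := g x) varK KA).
- move=> F G; rewrite -f_mono /= !gK => /clopen_down_c /preimage_clopen.
  move=> /(_ _ _ f_cont); congr clopen.
  by apply/seteqP; split=> P /=; rewrite -[P <= _]f_mono gK.
- by rewrite -f_mono /= !gK.
- by move=> d'' C KC; apply: p_monic_conj (monic_c _ _ KC).
Qed.

Section SumSpace.
Context {d : Order.disp_t} {X : nat -> ordSpaceType d}.
Implicit Types (k m : nat) (x : sumspace X) (U : set (sumspace X)).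

Definition summand {k} (y : X k) : sumspace X := Some (Tagged X y).

Lemma le_sum_top x : x <= None.
Proof. by case: x => [[]|]. Qed.

Lemma le_summand k (y z : X k) : (summand y <= summand z) = (y <= z).
Proof. by rewrite /Order.le /= ltnn eqxx tagged_asE. Qed.

Lemma le_summand_lt k m (y : X k) (z : X m) :
  (k < m)%N -> summand y <= summand z.
Proof. by rewrite /Order.le /= => ->. Qed.

Lemma le_summand_gt k m (y : X k) (z : X m) :
  (k < m)%N -> (summand z <= summand y) = false.
Proof. by rewrite /Order.le /= => km; rewrite ltnNge ltnW //= gtn_eqF. Qed.

Lemma clopen_sum U : (forall k, clopen (@summand k @^-1` U)) ->
  (exists k, forall m (y : X m), (k <= m)%N -> U (summand y) <-> U None) ->
  clopen U.
Proof.
move=> cU [k tailU]; split; last rewrite -openC; split=> [m|UN].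
- exact: (cU m).1.
- by exists k => m y /tailU->.
- exact: closed_openC (cU m).2.
- by exists k => m y /tailU yN /yN.
Qed.

Lemma clopen_down_summand k (y : X k) :
  clopen [set z | z <= y] -> clopen [set x | x <= summand y].
Proof.
move=> cy; apply: clopen_sum; last first.
  by exists k.+1 => m z km; split=> //=; rewrite le_summand_gt.
move=> m; case: (ltngtP m k) => [mk|km|mk].
- rewrite (_ : _ @^-1` _ = setT); first exact: clopenT.
  by apply/seteqP; split=> // z _ /=; exact: le_summand_lt.
- rewrite (_ : _ @^-1` _ = set0); first exact: clopen0.
  by apply/seteqP; split=> // z /=; rewrite le_summand_gt.
- case: k / mk y cy => y; congr clopen.
  by apply/seteqP; split=> z /=; rewrite le_summand.
Qed.

End SumSpace.

Section OmegaSum.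
Context {d : Order.disp_t} {Y : ordSpaceType d}.
Implicit Types (k m : nat) (y z : Y).

Definition omega_summand k y : omega_sum Y := @summand _ (fun=> Y) k y.

Lemma omega_summand_inj k m y z :
  omega_summand k y = omega_summand m z -> k = m /\ y = z.
Proof.
pose coords (x : omega_sum Y) :=
  if x is Some u then (tag u, tagged u : Y) else (k, y).
by move=> /(congr1 coords)[].
Qed.

Lemma le_omega_summand k m y z :
  (omega_summand k y <= omega_summand m z) = (k < m)%N || (k == m) && (y <= z).
Proof.
case: (ltngtP k m) => [km|mk|<-]; [exact: le_summand_lt|exact: le_summand_gt|].
exact: le_summand.
Qed.

End OmegaSum.

Section OmegaSumXX.
Context {n : nat}.
Implicit Types (i j : 'I_n.+1) (k m : nat).
Notation X := (omega_sum (XX n.+1)).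
Implicit Types x y : X.

Definition apt k i : X := omega_summand k (inl i : XX n.+1).
Definition bpt k i : X := omega_summand k (inr i : XX n.+1).

Lemma le_apt_apt k m i j :
  (apt k i <= apt m j) = (k < m)%N || (k == m) && (i == j).
Proof. by rewrite le_omega_summand [in LHS]/Order.le /= /XX_le orbF. Qed.

Lemma le_bpt_bpt k m i j :
  (bpt k i <= bpt m j) = (k < m)%N || (k == m) && (i == j).
Proof. by rewrite le_omega_summand [in LHS]/Order.le /= /XX_le orbF. Qed.

Lemma le_bpt_apt k m i j : (bpt k i <= apt m j) = (k < m)%N.
Proof. by rewrite le_omega_summand andbF orbF. Qed.

Lemma le_apt_bpt k m i j : (apt k i <= bpt m j) = (k < m)%N ||
  (k == m) && (if i == ord0 then j != ord0 else (j == ord0) || (j == i)).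
Proof. by rewrite le_omega_summand. Qed.

Definition le_ptE := (le_apt_apt, le_bpt_bpt, le_bpt_apt, le_apt_bpt).

(* The fibres are {b_1^k, a_1^(k+1)}, {a_m^k, b_m^k} for m > 1, and the
   singletons of a_1^0 and of the top element; each is sent to its maximum. *)
Definition collapse x : X :=
  match x with
  | None => None
  | Some (existT k (inl i)) => if i == ord0 then apt k i else bpt k i
  | Some (existT k (inr i)) => if i == ord0 then apt k.+1 i else bpt k i
  end.

Lemma collapse_apt k i : i != ord0 -> collapse (apt k i) = bpt k i.
Proof. by move=> /negPf /= ->. Qed.

Variant collapse_spec : X -> X -> Prop :=
  | CollapseTop : collapse_spec None None
  | CollapseApt0 k : collapse_spec (apt k ord0) (apt k ord0)
  | CollapseApt k i of i != ord0 : collapse_spec (apt k i) (bpt k i)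
  | CollapseBpt0 k : collapse_spec (bpt k ord0) (apt k.+1 ord0)
  | CollapseBpt k i of i != ord0 : collapse_spec (bpt k i) (bpt k i).

Lemma collapseP x : collapse_spec x (collapse x).
Proof.
case: x => [[k [i|i]]|] /=; [| |exact: CollapseTop];
  have [->|i0] := eqVneq i ord0.
- exact: CollapseApt0.
- exact: CollapseApt.
- exact: CollapseBpt0.
- exact: CollapseBpt.
Qed.

Lemma collapse_ge x : x <= collapse x.
Proof.
case: collapseP => [|k|k i i0|k|k i i0] //; rewrite !le_ptE //.
by rewrite (negPf i0) !eqxx !orbT.
Qed.

Lemma collapse_closure_op : closure_op collapse.
Proof.
move=> x y; apply/idP/idP; last exact/le_trans/collapse_ge.
case: (collapseP y) => [|m|m j j0|m|m j j0];
  case: (collapseP x) => [|k|k i i0|k|k i i0] //;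
  rewrite !le_ptE ?[ord0 == _]eq_sym ?[i == j]eq_sym;
  rewrite ?(negPf i0) ?(negPf j0) ?eqxx;
  by rewrite ?andbF ?andbT ?orbF ?ltnS ?eqSS // orbC -leq_eqVlt.
Qed.

Lemma collapse_thin_fibres : thin_fibres collapse.
Proof.
move=> x y.
case: (collapseP x) => [|k|k i i0|k|k i i0];
  case: (collapseP y) => [|m|m j j0|m|m j j0] e;
  try by [constructor 2|constructor 3].
- by have [-> [->]] := omega_summand_inj e; constructor 1.
- by have [[->] _] := omega_summand_inj e; constructor 1.
Qed.

Lemma clopen_down_collapse x y :
  ~~ (collapse x <= collapse y) -> clopen [set z | z <= collapse y].
Proof.
have clopenXX (D : set (XX n.+1)) : clopen D.
  by split; [exact: discrete_open|exact: discrete_closed].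
case: (collapseP y) => [|k|k i i0|k|k i i0]; first by rewrite le_sum_top.
all: by move=> _; exact: clopen_down_summand.
Qed.

Lemma ord_max_neq0 : (0 < n)%N -> ord_max != ord0 :> 'I_n.+1.
Proof. by rewrite -val_eqE -lt0n. Qed.

Section Coincidence.
Context {d : Order.disp_t} {Z : porderType d}.
Implicit Types (G H : Z -> X) (v w : Z).
Hypotheses (n_gt0 : (0 < n)%N) (width_Z : poset_width_le n.+1 Z).

Lemma no_apt_bpt_gap G H v k i : p_morphism G -> p_morphism H ->
    collapse \o G =1 collapse \o H -> i != ord0 ->
  G v = apt k i -> H v = bpt k i -> False.
Proof.
move=> pG pH cGH i0 Gv Hv.
have lift_G w x := p_morphism_lift_fibre (v := w) (x := x)
  collapse_closure_op collapse_thin_fibres pG pH cGH.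
have [||u [vu Gu Hu]] := lift_G v (bpt k ord0).
- by rewrite Gv !le_ptE (negPf i0) !eqxx orbT.
- by rewrite Hv !le_ptE ltnn eqxx (negPf i0).
have /choice[w wP] j : exists w,
    [/\ u <= w, G w = apt k.+1 j & H w = collapse (apt k.+1 j)].
  apply: lift_G; rewrite ?Gu ?Hu !le_ptE ?ltnSn // ltnn eqxx /=.
  by move=> /eqP<-.
have [|t vt Ht] := p_morphism_lift pH (x := v) (y := bpt k.+1 ord0).
  by rewrite Hv !le_ptE ltnSn.
(* G keeps the points [w j] apart, and H keeps [t] apart from them. *)
have [j|j l jl|j] := poset_width_comparable width_Z vt (w := w).
- by have [uw _ _] := wP j; exact: le_trans uw.
- have [_ Gj _] := wP j; have [_ Gl _] := wP l.
  apply/norP; split; apply/negP => /(p_morphism_homo pG);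
  by rewrite Gj Gl !le_ptE ltnn eqxx ?[l == _]eq_sym (negPf jl).
have [_ _ Hw] := wP j; move=> /orP[] /(p_morphism_homo pH);
  rewrite Ht Hw /=; case: eqVneq => [->|j0];
  by rewrite !le_ptE ltnn ?eqxx ?[ord0 == _]eq_sym ?(negPf j0).
Qed.

Lemma collapse_p_morphism_eq G H v : p_morphism G -> p_morphism H ->
  collapse \o G =1 collapse \o H -> H v = collapse (G v) -> G v = H v.
Proof.
move=> pG pH cGH.
case E: _ _ / (collapseP (G v)) => [|k|k i i0|k|k i i0] //= Hv.
  by have := no_apt_bpt_gap pG pH cGH i0 E Hv.
have max0 := ord_max_neq0 n_gt0.
have [| |w [_ Gw]] := p_morphism_lift_fibre (v := v) (x := apt k.+1 ord_max)
    collapse_closure_op collapse_thin_fibres pG pH cGH.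
- by rewrite E le_ptE ltnSn.
- by rewrite Hv le_ptE ltnn eqxx eq_sym (negPf max0).
by rewrite collapse_apt // => /(no_apt_bpt_gap pG pH cGH max0 Gw).
Qed.

Lemma collapse_p_monic : p_monic Z collapse.
Proof.
move=> G H pG pH cGH v; have [//|Gv|Hv] := collapse_thin_fibres (cGH v).
  have cHG : collapse \o H =1 collapse \o G by move=> w; rewrite cGH.
  by apply/esym/(collapse_p_morphism_eq pH pG cHG); rewrite Gv; exact: cGH.
by apply: (collapse_p_morphism_eq pG pH cGH); rewrite Hv; exact/esym/cGH.
Qed.

End Coincidence.

End OmegaSumXX.

Local Close Scope order_scope.
Local Close Scope classical_set_scope.

Theorem theorem6p5 (n : nat) (K : heytingClass)
    (hn : 2 <= n) (hK : variety K)
    (hwidth : forall (d : Order.disp_t) (A : heytingType d),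
      K d A -> heyting_width_le n A)
    (hX : dual_class K (omega_sum (XX n))) :
  ~ ES_property K.
Proof.
case: n hn hwidth hX => // n; rewrite ltnS => n_gt0 width dualX.
apply: (not_ES_closure_op (x := apt 0 ord_max) hK dualX collapse_closure_op).
- exact: clopen_down_collapse.
- by rewrite collapse_apt ?ord_max_neq0 ?le_bpt_apt.
- by move=> d C /width; exact: collapse_p_monic.
Qed.
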